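(* Let $D$ be a digraph. For every integer $l$ with $dc(D)\leq l\leq dac(D)$ there is a dihomomorphic image $F$ of $D$ with $dc(F)=l$.
   Context: Digraphs are finite, without loops and without parallel arcs (both $(x,y)$ and $(y,x)$ may be arcs). A vertex coloring of a digraph $D$ with $k$ colors is a surjective function $V(D)\to[k]=\{1,\dots,k\}$; the preimages of the colors are the chromatic classes. A coloring is acyclic if no chromatic class induces a subdigraph containing a directed cycle (a 2-cycle $x\to y\to x$ counts as a directed cycle). A coloring is complete if for every ordered pair $(i,j)$ of different colors there is at least one arc $(x,y)$ such that $x$ has color $i$ and $y$ has color $j$. The dichromatic number $dc(D)$ is the smallest $k$ such that $D$ has an acyclic coloring with $k$ colors. The diachromatic number $dac(D)$ is the largest $k$ such that $D$ has a complete and acyclic coloring with $k$ colors. Two distinct vertices $u,v$ of $D$ are adjacent if they form a 2-cycle, i.e. both $(u,v)$ and $(v,u)$ are arcs; otherwise they are nonadjacent. An elementary dihomomorphism $\epsilon$ of $D$ identifies two distinct nonadjacent vertices $u$ and $v$: the resulting digraph $\epsilon(D)$ has vertex set $V(D)\setminus\{u\}$ and arc set $\{(x,y)\in A(D): x,y\in V(D)\setminus\{u\}\}\cup\{(v,x):(u,x)\in A(D),\ x\in V(D)\setminus\{u,v\}\}\cup\{(x,v):(x,u)\in A(D),\ x\in V(D)\setminus\{u,v\}\}$. A digraph $F$ is a dihomomorphic image of $D$ if $F$ can be obtained (up to isomorphism) from $D$ by a finite, possibly empty, sequence of elementary dihomomorphisms. *)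

(* Defs.v *)
From mathcomp Require Import all_boot.
From mathcomp Require Import boolp.

Set Implicit Arguments.
Unset Strict Implicit.
Unset Printing Implicit Defensive.

Record digraph := Digraph {
  vertex :> finType;
  arc : rel vertex;
  arc_irr : irreflexive arc }.

Lemma induced_irr (D : digraph) (A : {set D}) :
  irreflexive (fun x y : {x : D | x \in A} => arc (val x) (val y)).
Proof. by move=> x; apply: arc_irr. Qed.

Definition induced (D : digraph) (A : {set D}) : digraph :=
  Digraph (@induced_irr D A).

(* The cycle goes through the vertices of c in order, then from the last one
   back to the first; length 2 is allowed. *)
Definition has_dicycle (D : digraph) : Prop :=
  exists c : seq D, [/\ 1 < size c, uniq c & cycle (@arc D) c].

(* Colors are numbered from 0: [k] is rendered as 'I_k. *)
Definition coloring (D : digraph) (k : nat) (f : D -> 'I_k) : Prop :=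
  forall i, exists x, f x = i.

Definition chromatic_class (D : digraph) (k : nat) (f : D -> 'I_k) (i : 'I_k) :
  {set D} := [set x | f x == i].

Definition acyclic_coloring (D : digraph) (k : nat) (f : D -> 'I_k) : Prop :=
  coloring f /\ forall i, ~ has_dicycle (induced (chromatic_class f i)).

Definition complete_coloring (D : digraph) (k : nat) (f : D -> 'I_k) : Prop :=
  forall i j, i != j -> exists x y, [/\ f x = i, f y = j & arc x y].

Definition acyclic_colorable (D : digraph) (k : nat) : Prop :=
  exists f : D -> 'I_k, acyclic_coloring f.

Definition complete_acyclic_colorable (D : digraph) (k : nat) : Prop :=
  exists f : D -> 'I_k, acyclic_coloring f /\ complete_coloring f.

Lemma no_dicycle_class (D : digraph) (k : nat) (f : D -> 'I_k) (i : 'I_k) :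
  ~ has_dicycle (induced (chromatic_class f i)) <->
  (forall c : seq D, 1 < size c -> uniq c -> cycle (@arc D) c ->
     ~ all (fun x => f x == i) c).
Proof.
split=> [nc c c1 uc cc fc|nc [c [c1 uc cc]]].
  have /all_sigP [s Es] : all (mem (chromatic_class f i)) c.
    by apply: sub_all fc => x; rewrite /= inE.
  apply: nc; exists s; split; first by rewrite Es size_map in c1.
    by move: uc; rewrite Es; apply: map_uniq.
  by move: cc; rewrite Es cycle_map.
apply: (nc (map val c)); rewrite ?size_map ?cycle_map //.
  by rewrite map_inj_uniq //; apply: val_inj.
by apply/allP => _ /mapP [x _ ->]; have := valP x; rewrite inE.
Qed.

Lemma acyclic_colorable_exists (D : digraph) :
  exists k, `[< acyclic_colorable D k >].
Proof.
exists #|D|; apply/asboolP; exists enum_rank; split=> [i|i].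
  by exists (enum_val i); apply: enum_valK.
apply/no_dicycle_class => -[|x [|y c]] //= _ /andP [+ _] _ /and3P [/eqP xi /eqP yi _].
by rewrite inE (enum_rank_inj (etrans xi (esym yi))) eqxx.
Qed.

Definition dc (D : digraph) : nat := ex_minn (acyclic_colorable_exists D).

Lemma dc_colorable (D : digraph) : acyclic_colorable D (dc D).
Proof. by rewrite /dc; case: ex_minnP => k /asboolP. Qed.

Lemma dc_le (D : digraph) (k : nat) : acyclic_colorable D k -> dc D <= k.
Proof. by rewrite /dc => h; case: ex_minnP => m _; apply; apply/asboolP. Qed.

Lemma min_coloring_complete (D : digraph) (k : nat) (f : D -> 'I_k) :
  k <= dc D -> acyclic_coloring f -> complete_coloring f.
Proof.
move=> kdc [fs fa] i j ij; apply: contrapT => noarc.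
have arcij x y : f x = i -> f y = j -> ~~ arc x y.
  by move=> xi yj; apply/negP => xy; apply: noarc; exists x, y.
case: k => [|k] in f kdc fs fa i j ij noarc arcij *.
  by case: i {ij noarc arcij}.
suff /dc_le /(leq_trans kdc) : acyclic_colorable D k by rewrite ltnn.
move: ij; rewrite eq_sym => /unlift_some [m0 im0 _].
pose r y := odflt m0 (unlift j y).
have rK m : r (lift j m) = m by rewrite /r liftK.
have liftr y : lift j (r y) = if y == j then i else y.
  rewrite /r; case: unliftP => [m ->|->] /=; last by rewrite eqxx im0.
  by rewrite eq_sym (negPf (neq_lift j m)).
exists (r \o f); split=> [m|m].
  by have [x fx] := fs (lift j m); exists x; rewrite /= fx rK.
apply/no_dicycle_class => c c1 uc cc /allP cm.
have fc x : x \in c -> lift j m = if f x == j then i else f x.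
  by move=> /cm /eqP /= <-; rewrite liftr.
pose fail_in l := (no_dicycle_class f l).1 (fa l).
have [/hasP [x xc /eqP fxi]|/hasPn ni] := boolP (has (fun x => f x == i) c).
  have mi : lift j m = i by rewrite (fc x xc) fxi; case: eqP.
  have [n c' rc] := rot_to xc.
  have sub y : y \in x :: c' -> f y = i \/ f y = j.
    rewrite -rc mem_rot => /fc; rewrite mi.
    by case: eqP => [-> _|_ ->]; [right|left].
  apply: (fail_in i (rot n c)); rewrite ?size_rot ?rot_uniq ?rot_cycle //.
  have : path (@arc D) x c'.
    by move: cc; rewrite -(rot_cycle n) rc /= rcons_path => /andP [].
  rewrite rc /= fxi eqxx /=.
  elim: c' x fxi sub {rc xc} => //= y c' IH x fxi sub /andP [xy yp].
  have fyi : f y = i.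
    have [|//|fyj] := sub y; first by rewrite !inE eqxx orbT.
    by have := arcij _ _ fxi fyj; rewrite xy.
  rewrite fyi eqxx; apply: IH fyi _ yp => z zc.
  by apply: sub; rewrite inE zc orbT.
have [mi|mi] := eqVneq (lift j m) i.
  apply: (fail_in j c) => //; apply/allP => x xc.
  have := fc x xc; rewrite mi; case: eqP => // _ fxi.
  by have := ni x xc; rewrite -fxi eqxx.
apply: (fail_in (lift j m) c) => //; apply/allP => x xc.
by have := fc x xc; case: eqP => [_ mi'|_ ->//]; rewrite mi' eqxx in mi.
Qed.

Lemma complete_acyclic_colorable_exists (D : digraph) :
  exists k, `[< complete_acyclic_colorable D k >].
Proof.
exists (dc D); apply/asboolP; have [f fa] := dc_colorable D.
by exists f; split=> //; apply: min_coloring_complete fa.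
Qed.

Lemma complete_acyclic_colorable_le (D : digraph) (k : nat) :
  `[< complete_acyclic_colorable D k >] -> k <= #|D|.
Proof.
move=> /asboolP [f [[fs _] _]].
have [g gK] := choice fs.
by have := leq_card g (can_inj gK); rewrite card_ord.
Qed.

Definition dac (D : digraph) : nat :=
  ex_maxn (complete_acyclic_colorable_exists D)
          (@complete_acyclic_colorable_le D).

Definition adjacent (D : digraph) (u v : D) : bool := arc u v && arc v u.

Section Identify.
Variables (D : digraph) (u v : D).

Definition identify_arc (x y : {x : D | x != u}) : bool :=
  [|| arc (val x) (val y),
      [&& val x == v, arc u (val y) & val y != v] |
      [&& val y == v, arc (val x) u & val x != v]].

Lemma identify_arc_irr : irreflexive identify_arc.
Proof.
by move=> x; rewrite /identify_arc arc_irr /=; case: eqP; rewrite ?andbF.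
Qed.

(* Meaningful for distinct nonadjacent u and v: the vertex u is absorbed by v. *)
Definition identify : digraph := Digraph identify_arc_irr.

End Identify.

Definition isomorphic (D F : digraph) : Prop :=
  exists2 g : D -> F, bijective g & forall x y, arc (g x) (g y) = arc x y.

Inductive dihom_image (D F : digraph) : Prop :=
| DihomIso of isomorphic D F
| DihomStep (u v : D) of
    u != v & ~~ adjacent u v & dihom_image (identify u v) F.

(* Main.v *)
Require Import Defs.
From mathcomp Require Import all_boot.
From mathcomp Require Import boolp.
Import Defs.

(** Start from a complete acyclic coloring of [D] with [dac D] colors.  As long
    as some chromatic class has two vertices, two of them can be identified so
    that the coloring stays complete and acyclic ([identify_class_acyclic]):
    take a sink [u] of the class and a sink [v] of what remains of the class
    without [u].  They are nonadjacent because [u] has no arc to [v], and the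
    merged vertex is a sink of the new class, so no new monochromatic cycle
    passes through it.  The process stops when the coloring is injective; the
    digraph is then complete and its dichromatic number is its order, [dac D].

    One identification raises the dichromatic number by at most one, since the
    merged vertex can be given a color of its own ([dc_identify]).  So the
    dichromatic numbers met along the way start at [dc D], end at [dac D] and
    never jump upwards over a value: every [l] in between is attained, by
    a discrete intermediate value argument ([dihom_image_dc]). *)

Set Implicit Arguments.
Unset Strict Implicit.
Unset Printing Implicit Defensive.

(** Colors range over an arbitrary type and need not all be used, so that a
    coloring can be given a fresh color or restricted without renumbering. *)
Definition acyclic_fibers (D : digraph) (T : eqType) (f : D -> T) : Prop :=
  forall (t : T) (c : seq D), 1 < size c -> uniq c -> cycle (@arc D) c ->
    ~ all (fun x => f x == t) c.

Lemma acyclic_coloring_fibers (D : digraph) (k : nat) (f : D -> 'I_k) :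
  acyclic_coloring f <-> coloring f /\ acyclic_fibers f.
Proof.
by split=> -[fs fa]; split=> // i; apply/no_dicycle_class; apply: fa.
Qed.

(** Unused colors are discarded by numbering only the image of the coloring. *)
Lemma dc_le_card (D : digraph) (T : finType) (f : D -> T) :
  acyclic_fibers f -> dc D <= #|T|.
Proof.
move=> fa; apply: leq_trans (max_card (mem (codom f))).
apply: dc_le; pose T' := {t : T | t \in codom f}.
have -> : #|codom f| = #|{: T'}| by rewrite card_sig.
pose g x : T' := Sub (f x) (codom_f f x).
exists (enum_rank \o g); apply/acyclic_coloring_fibers; split=> [i|i c c1 uc cc].
  have [x fx] := codomP (valP (enum_val i)).
  exists x => /=; rewrite -[RHS]enum_valK; congr enum_rank.
  exact/val_inj/esym.
move=> ci; apply: (fa (val (enum_val i)) c) => //.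
by apply: sub_all ci => x /eqP <-; rewrite /= enum_rankK.
Qed.

(** Among the vertices of [A], one with the fewest vertices reachable inside
    [A] is a sink: an out-neighbor in [A] reaches no fewer vertices, hence
    reaches it back, which closes a directed cycle. *)
Lemma sink_exists (D : digraph) (A : {set D}) (x0 : D) :
  (forall c, 1 < size c -> uniq c -> cycle (@arc D) c -> ~ all (mem A) c) ->
  x0 \in A -> exists2 x, x \in A & forall y, y \in A -> ~~ arc x y.
Proof.
move=> nc x0A; pose e : rel D := [rel x y | (y \in A) && arc x y].
case: (arg_minnP (fun x => #|connect e x|) x0A) => x xA xmin.
exists x => // y yA; apply/negP => xy.
have exy : e x y by apply/andP.
have yx : connect e y x.
  have sub : connect e y \subset connect e x.
    by apply/subsetP => z; apply: connect_trans (connect1 exy).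
  have /subset_leqif_card := sub.
  move=> /leqifP; case: ifP => [/subsetP sxy _|_].
    by apply: sxy; apply: connect0.
  by rewrite ltnNge (xmin y yA).
case/connectP: yx => p yp xl; case/shortenP: yp xl => q yq uq _ xl.
have ec : cycle e (y :: q) by rewrite /= rcons_path yq -xl.
apply: (nc (y :: q)) => //.
- by case: q xl {yq uq ec} => //= xy'; rewrite xy' arc_irr in xy.
- by apply: sub_cycle ec => a b /andP [].
apply/allP => z zc; have := prev_cycle ec zc.
by case/andP.
Qed.

(** Only arcs at the merged vertex [v] are new. *)
Lemma identify_cycle (D : digraph) (u v : D) (c : seq (identify u v)) :
  all (fun x => val x != v) c -> cycle (@arc (identify u v)) c ->
  cycle (@arc D) (map val c).
Proof.
move=> cv; rewrite cycle_map; apply: sub_in_cycle cv => x y.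
rewrite !unfold_in => /negPf xv /negPf yv.
by rewrite /= /identify_arc xv yv !orbF.
Qed.

Lemma identify_avoid (D : digraph) (u v : D) (T : eqType) (f : D -> T) t
    (c : seq (identify u v)) :
  acyclic_fibers f -> all (fun x => val x != v) c -> 1 < size c -> uniq c ->
  cycle (@arc (identify u v)) c -> ~ all (fun x => f (val x) == t) c.
Proof.
move=> fa cv c1 uc cc ct; apply: (fa t (map val c)); rewrite ?size_map //.
- by rewrite map_inj_uniq //; apply: val_inj.
- exact: identify_cycle cc.
by rewrite all_map.
Qed.

(** Give the merged vertex a color of its own: every other class is then part of
    a class of [D], with the same arcs. *)
Lemma dc_identify (D : digraph) (u v : D) : dc (identify u v) <= (dc D).+1.
Proof.
have [f /acyclic_coloring_fibers [_ fa]] := dc_colorable D.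
pose g (x : identify u v) := if val x == v then None else Some (f (val x)).
suff /dc_le_card : acyclic_fibers g by rewrite card_option card_ord.
move=> [i|] c c1 uc cc ci.
  apply: (@identify_avoid _ _ _ _ f i c fa _ c1 uc cc).
    by apply: sub_all ci => x; rewrite /g; case: ifP.
  by apply: sub_all ci => x; rewrite /g; case: ifP.
case: c c1 uc {cc} ci => [|x [|y c]] //= _ /andP [xyc _] /and3P [].
rewrite /g; case: (val x =P v) => // xv _; case: (val y =P v) => // yv _ _.
by rewrite inE -val_eqE /= xv yv eqxx in xyc.
Qed.

(** The merged vertex has no arc into its own class, so no monochromatic cycle
    goes through it; the ones that avoid it already lie in [D]. *)
Lemma identify_class_acyclic (D : digraph) (T : eqType) (f : D -> T) (u v : D) :
  acyclic_fibers f ->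
  (forall y, f y = f v -> ~~ arc u y) ->
  (forall y, f y = f v -> y != u -> ~~ arc v y) ->
  acyclic_fibers (fun x : identify u v => f (val x)).
Proof.
move=> fa usink vsink t c c1 uc cc ct.
apply: (@identify_avoid _ u v _ f t c fa _ c1 uc cc ct).
apply/allP => x xc; apply/eqP => xv.
have fc z : z \in c -> f (val z) = t by move/(allP ct)/eqP.
have := next_cycle cc xc; set y := next c x.
have yv : f (val y) = f v by rewrite -xv !fc // mem_next.
rewrite /= /identify_arc xv !eqxx /= (negPf (usink _ yv)).
by rewrite (negPf (vsink _ yv (valP y))) !andbF.
Qed.

(** Arcs between distinct classes survive: redirecting [u] to [v] creates no
    loop there, since its ends keep their colors. *)
Lemma identify_complete (D : digraph) (k : nat) (f : D -> 'I_k) (u v : D) :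
  u != v -> f u = f v -> coloring f -> complete_coloring f ->
  let g := fun x : identify u v => f (val x) in
  coloring g /\ complete_coloring g.
Proof.
move=> uv fuv fs fc g; have vu : v != u by rewrite eq_sym.
pose r (x : D) : identify u v := insubd (Sub v vu) x.
have rE x : val (r x) = if x == u then v else x.
  by rewrite val_insubd; case: eqP.
have gr x : g (r x) = f x by rewrite /g rE; case: eqP => // ->.
split=> [i|i j ij]; first by have [x <-] := fs i; exists (r x).
have [x [y [xi yj xy]]] := fc i j ij.
exists (r x), (r y); split; rewrite ?gr //.
have fxy : f x != f y by rewrite xi yj.
rewrite /= /identify_arc !rE.
have [xu|_] := eqVneq x u; have [yu|_] := eqVneq y u.
- by rewrite xu yu eqxx in fxy.
- suff yv : y != v by rewrite -xu xy yv eqxx orbT.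
  by apply: contraNneq fxy => ->; rewrite xu fuv.
- suff xv : x != v by rewrite -yu xy xv eqxx !orbT.
  by apply: contraNneq fxy => ->; rewrite yu fuv.
by rewrite xy.
Qed.

(** With fewer colors than vertices two vertices share a class, and being
    joined both ways they form a directed 2-cycle in it. *)
Lemma dc_adjacent (D : digraph) :
  (forall x y : D, x != y -> arc x y) -> #|D| <= dc D.
Proof.
move=> adj; have [f /acyclic_coloring_fibers [_ fa]] := dc_colorable D.
suff /leq_card : injective f by rewrite card_ord.
move=> x y fxy; apply: contrapT => /eqP xy.
apply: (fa (f x) [:: x; y]) => //=; last by rewrite fxy eqxx.
  by rewrite inE xy.
by rewrite !adj // eq_sym.
Qed.

(** [u] is a sink of the class and [v] a sink of the class without [u].  An
    arbitrary nonadjacent pair would not do: on a path [u -> w -> v] inside the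
    class, merging the ends creates a 2-cycle through [w]. *)
Lemma class_sinks (D : digraph) (T : eqType) (f : D -> T) (x y : D) :
  acyclic_fibers f -> x != y -> f x = f y ->
  exists u v, [/\ u != v, f u = f v,
    forall z, f z = f v -> ~~ arc u z &
    forall z, f z = f v -> z != u -> ~~ arc v z].
Proof.
move=> fa xy fxy.
have nc (A : {set D}) : (forall z, z \in A -> f z = f x) ->
    forall c, 1 < size c -> uniq c -> cycle (@arc D) c -> ~ all (mem A) c.
  move=> Af c c1 uc cc cA; apply: (fa (f x) c) => //.
  by apply: sub_all cA => z /Af ->.
pose A := [set z | f z == f x].
have [||u uA us] := @sink_exists D A x; first apply: nc.
- by move=> z; rewrite inE => /eqP.
- by rewrite inE.
have [w wA wu] : exists2 w, w \in A & w != u.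
  have [xu|xu] := eqVneq x u; last by exists x; rewrite // inE.
  by exists y; rewrite ?inE ?fxy // -xu eq_sym.
have [||v] := @sink_exists D (A :\ u) w; first apply: nc.
- by move=> z; rewrite !inE => /andP [_ /eqP].
- by rewrite in_setD1 wu.
rewrite !inE in uA * => /andP [vu /eqP fv] vs.
exists u, v; split=> [||z fz|z fz zu].
- by rewrite eq_sym.
- by rewrite fv; apply/eqP.
- by apply: us; rewrite inE fz fv.
by apply: vs; rewrite !inE zu fz fv eqxx.
Qed.

Lemma dihom_image_refl (D : digraph) : dihom_image D D.
Proof. by apply: DihomIso; exists id => //; exists id. Qed.

Lemma card_identify (D : digraph) (u v : D) : #|identify u v| < #|D|.
Proof.
by rewrite card_sig (cardC1 u) ltn_predL; apply/card_gt0P; exists u.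
Qed.

(** Induction on the order of [D].  The complete acyclic coloring with [k >= l]
    colors is carried along because it guarantees that an identification is
    possible as long as the dichromatic number is below [l]. *)
Lemma dihom_image_dc (D : digraph) (k l : nat) (f : D -> 'I_k) :
  acyclic_coloring f -> complete_coloring f -> dc D <= l <= k ->
  exists F : digraph, dihom_image D F /\ dc F = l.
Proof.
have [n] := ubnP #|D|; elim: n => // n IH in D f *; rewrite ltnS => Dn.
move=> /acyclic_coloring_fibers [fs fa] fc /andP [].
rewrite leq_eqVlt => /orP [/eqP <- _|dl lk].
  by exists D; split; first apply: dihom_image_refl.
have [/injectiveP f_inj|/injectivePn [x [y xy fxy]]] := boolP (injectiveb f).
  (* The coloring is injective and complete: D is complete of order k > dc D. *)
  have Dk : k <= #|D|.
    have [h hK] := choice fs.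
    by have := leq_card h (can_inj hK); rewrite card_ord.
  have /dc_adjacent Ddc : forall a b : D, a != b -> arc a b.
    move=> a b ab; have [|a' [b' [fa' fb' ab']]] := fc (f a) (f b).
      by apply: contra_neq ab => /f_inj.
    by rewrite -(f_inj _ _ fa') -(f_inj _ _ fb').
  by have := leq_trans dl (leq_trans lk (leq_trans Dk Ddc)); rewrite ltnn.
have [u [v [uv fuv us vs]]] := class_sinks fa xy fxy.
have [gs gc] := identify_complete uv fuv fs fc.
have [F [DF dF]] : exists F, dihom_image (identify u v) F /\ dc F = l.
  apply: IH gc _; first exact: leq_trans (card_identify u v) Dn.
    by apply/acyclic_coloring_fibers; split; last exact: identify_class_acyclic.
  by rewrite lk (leq_trans (dc_identify u v)).
exists F; split=> //; apply: DihomStep DF => //.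
by rewrite /adjacent (negPf (us v _)).
Qed.

Theorem theorem22 (D : digraph) (l : nat) (hl : dc D <= l <= dac D) :
  exists F : digraph, dihom_image D F /\ dc F = l.
Proof.
move: hl; rewrite /dac; case: ex_maxnP => k /asboolP [f [fa fc]] _.
exact: dihom_image_dc fa fc.
Qed.
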